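(* Let $(E,C)$ be a separated graph without isolated vertices. Let $\mathfrak U'$ be the set of all non-trivial lower subsets $Z'$ of $\mathbb F_C(v)$ such that $Z'_g$ is a maximal local configuration for all $g\in Z'$, where $v$ ranges over all vertices of $E$. Then there is a bijection $\mathfrak U'\cong\mathfrak U$ between $\mathfrak U'$ and the set of ultrafilters $\mathfrak U$.
   Context: A directed graph $E=(E^0,E^1,s,r)$ consists of sets $E^0$, $E^1$ (arbitrary cardinality) and maps $s,r\colon E^1\to E^0$. A separated graph $(E,C)$ is a directed graph with $C=\bigsqcup_{v}C_v$, where $C_v$ is a partition of $s^{-1}(v)$ into pairwise disjoint nonempty subsets ($C_v=\emptyset$ if $s^{-1}(v)=\emptyset$). A vertex $v$ is isolated if $s^{-1}(v)=r^{-1}(v)=\emptyset$. $E^{-1}=\{e^{-1}:e\in E^1\}$ is a set of formal inverses, $\hat E^1=E^1\sqcup E^{-1}$, $s(e^{-1})=r(e)$, $r(e^{-1})=s(e)$, $(e^{-1})^{-1}=e$. A path is a vertex or a word $y_1\cdots y_n$ with $y_i\in\hat E^1$, $r(y_i)=s(y_{i+1})$; it is reduced if it contains no subword $xx^{-1}$, $x\in\hat E^1$; $\mathrm{red}(\gamma)$ is the reduction of $\gamma$ via $xx^{-1}\to s(x)$, and $g\cdot h=\mathrm{red}(gh)$ when $r(g)=s(h)$. $\mathbb F_C$ is the set of $C$-separated paths: reduced paths (vertices included) with no subword $x^{-1}y$ with $x,y\in X$, $X\in C$; $\mathbb F_C(v)=\{w\in\mathbb F_C:s(w)=v\}$. The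 prefix order $\mu\le_p\nu$ means that $\mu$ is an initial segment of $\nu$; lower subsets are with respect to $\le_p$; a lower subset $Z$ of $\mathbb F_C(v)$ is non-trivial if $|Z|\ge2$. Vertices count as not ending in $E^{-1}$. $\gamma,\nu\in\mathbb F_C(v)\setminus\{v\}$ are $C$-compatible if $\mathrm{red}(\nu^{-1}\gamma)\in\mathbb F_C$; $v$ is $C$-compatible with all elements of $\mathbb F_C(v)$; a subset of $\mathbb F_C(v)$ is $C$-compatible if its elements are pairwise $C$-compatible. A local configuration at $v\in E^0$ is a nonempty subset $\mathfrak c\subseteq\{x\in\hat E^1:s(x)=v\}$; it is admissible if it is $C$-compatible (equivalently, contains no two distinct edges from the same $X\in C_v$), and maximal if it is admissible and not properly contained in another admissible local configuration at $v$. For a non-trivial lower subset $Z$ of $\mathbb F_C(v)$ and $g\in Z$, $Z_g=\{x\in\hat E^1:s(x)=r(g),\ g\cdot x\in Z\}$, a local configuration at $r(g)$. $\mathfrak F(v)$ is the set of all (possibly infinite) nonempty $C$-compatible lower subsets $Z$ of $\mathbb F_C(v)$ such that each $z\in Z$ is a prefix of an element of $Z$ not ending in $E^{-1}$; $\mathfrak F=\bigsqcup_v\mathfrak F(v)$ is ordered by inclusion, and $\mathfrak U$ is the set of its maximal elements. ($\mathfrak F$ is identified with the space of filters, and $\mathfrak U$ with the set of ultrafilters, on the semilattice of idempotents of the inverse semigroup of $(E,C)$.) *)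

(* Defs.v *)
From mathcomp Require Import all_boot.
From mathcomp Require Import boolp classical_sets functions.

Set Implicit Arguments.
Unset Strict Implicit.
Unset Printing Implicit Defensive.

Local Open Scope classical_set_scope.

Record digraph := Digraph {
  vert : Type;
  edge : Type;
  src : edge -> vert;
  rng : edge -> vert }.

Record sepgraph := SepGraph {
  sg_graph :> digraph;
  sg_part : vert sg_graph -> set (set (edge sg_graph));
  sg_partP : forall v, partition (sg_part v) id [set e | src e = v] }.

Section SeparatedGraph.
Variable G : sepgraph.

Definition isolated (v : vert G) : Prop :=
  [set e : edge G | src e = v] = set0 /\ [set e : edge G | rng e = v] = set0.

(* The family C, i.e. the union of the C_v. *)
Definition sep_class : set (set (edge G)) :=
  [set X | exists v : vert G, sg_part v X].

(* [Fwd e] is the edge e and [Inv e] its formal inverse. *)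
Inductive letter := Fwd of edge G | Inv of edge G.

Definition lsrc (x : letter) : vert G :=
  match x with Fwd e => src e | Inv e => rng e end.
Definition lrng (x : letter) : vert G :=
  match x with Fwd e => rng e | Inv e => src e end.
Definition linv (x : letter) : letter :=
  match x with Fwd e => Inv e | Inv e => Fwd e end.

(* A path is stored as its source together with its word, so that the vertex v
   is (v, [::]); the requirement that consecutive letters match is [is_path]. *)
Definition gpath : Type := (vert G * seq letter)%type.

Fixpoint chain (v : vert G) (w : seq letter) : Prop :=
  if w is x :: w' then lsrc x = v /\ chain (lrng x) w' else True.

Definition is_path (g : gpath) : Prop := chain g.1 g.2.

Definition psrc (g : gpath) : vert G := g.1.
Definition prng (g : gpath) : vert G := last g.1 (map lrng g.2).

Definition vpath (v : vert G) : gpath := (v, [::]).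
Definition lpath (x : letter) : gpath := (lsrc x, [:: x]).

Definition pcat (g h : gpath) : gpath := (g.1, g.2 ++ h.2).
Definition pinv (g : gpath) : gpath := (prng g, rev (map linv g.2)).

Definition subword (u w : seq letter) : Prop := exists a b, w = a ++ u ++ b.

Definition reduced (w : seq letter) : Prop :=
  forall x, ~ subword [:: x; linv x] w.

(* Since the edges form an arbitrary type, letters are compared classically. *)
Definition cons_red (x : letter) (w : seq letter) : seq letter :=
  if w is y :: w' then (if `[< y = linv x >] then w' else x :: w) else [:: x].

Definition wred (w : seq letter) : seq letter := foldr cons_red [::] w.

(* [wred w] is a reduced word obtained from [w] by deletions of factors
   x x^-1; this is the content of [wred_cancels] and [wred_reduced]. *)
Inductive cancels : seq letter -> seq letter -> Prop :=
| cancels_refl w : cancels w w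
| cancels_step a x b w :
    cancels (a ++ b) w -> cancels (a ++ [:: x; linv x] ++ b) w.

Lemma cancels_trans w1 w2 w3 : cancels w1 w2 -> cancels w2 w3 -> cancels w1 w3.
Proof. by elim=> // a x b w _ IH /IH; apply: cancels_step. Qed.

Lemma cancels_cons x w1 w2 : cancels w1 w2 -> cancels (x :: w1) (x :: w2).
Proof.
elim=> [w|a y b w _ IH]; first exact: cancels_refl.
by apply: (@cancels_step (x :: a)).
Qed.

Lemma wred_cancels w : cancels w (wred w).
Proof.
elim: w => [|x w IH] /=; first exact: cancels_refl.
apply: cancels_trans (cancels_cons x IH) _.
case: (wred w) => [|y w'] /=; first exact: cancels_refl.
case: asboolP => [->|_]; last exact: cancels_refl.
by apply: (@cancels_step [::]); apply: cancels_refl.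
Qed.

Lemma wred_reduced w : reduced (wred w).
Proof.
elim: w => [|x w IH] /= z [a [b]]; first by case: a.
case E: (wred w) => [|y w'] /=; first by case: a => [|? [|? ?]].
case: asboolP => [_ E'|yx].
  by apply: (IH z); exists (y :: a), b; rewrite E E'.
case: a => [[<- yE _]|c a [_ E']]; first exact: yx.
by apply: (IH z); exists a, b; rewrite E E'.
Qed.

Definition path_red (g : gpath) : gpath := (g.1, wred g.2).

(* g . h = red (g h), meaningful when [prng g = psrc h]. *)
Definition pdot (g h : gpath) : gpath := path_red (pcat g h).

Definition sep_paths : set gpath :=
  [set g | [/\ is_path g, reduced g.2 &
    forall (X : set (edge G)) (e f : edge G), sep_class X -> X e -> X f ->
      ~ subword [:: Inv e; Fwd f] g.2]].

Definition sep_paths_at (v : vert G) : set gpath :=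
  [set g | sep_paths g /\ psrc g = v].

Definition pprefix (g h : gpath) : Prop :=
  g.1 = h.1 /\ exists u, h.2 = g.2 ++ u.

Definition ends_in_inv (g : gpath) : Prop := exists u e, g.2 = rcons u (Inv e).

Definition lower_subset (v : vert G) (Z : set gpath) : Prop :=
  Z `<=` sep_paths_at v /\ forall g h, pprefix g h -> Z h -> Z g.

Definition nontrivial (Z : set gpath) : Prop := exists g h, [/\ Z g, Z h & g <> h].

Definition compat (v : vert G) (g h : gpath) : Prop :=
  [\/ g = vpath v, h = vpath v | sep_paths (pdot (pinv h) g)].

Definition compatible_set (v : vert G) (Z : set gpath) : Prop :=
  Z `<=` sep_paths_at v /\ forall g h, Z g -> Z h -> compat v g h.

Definition local_config (v : vert G) (c : set letter) : Prop :=
  c !=set0 /\ c `<=` [set x | lsrc x = v].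

Definition admissible (v : vert G) (c : set letter) : Prop :=
  local_config v c /\ compatible_set v (lpath @` c).

Definition maximal_config (v : vert G) (c : set letter) : Prop :=
  admissible v c /\ forall d, admissible v d -> c `<=` d -> d = c.

Definition config_at (Z : set gpath) (g : gpath) : set letter :=
  [set x | lsrc x = prng g /\ Z (pdot g (lpath x))].

Definition frakF_at (v : vert G) : set (set gpath) :=
  [set Z | [/\ Z !=set0, lower_subset v Z, compatible_set v Z &
    forall z, Z z -> exists z', [/\ Z z', pprefix z z' & ~ ends_in_inv z']]].

(* Members of [frakF_at v] are nonempty sets of paths with source v, so the
   union over v is disjoint and inclusion only relates members over the same
   vertex; the same holds for [frakU'] below. *)
Definition frakF : set (set gpath) := \bigcup_v frakF_at v.

Definition frakU : set (set gpath) :=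
  [set Z | frakF Z /\ forall Z', frakF Z' -> Z `<=` Z' -> Z' = Z].

Definition frakU'_at (v : vert G) : set (set gpath) :=
  [set Z | [/\ lower_subset v Z, nontrivial Z &
    forall g, Z g -> maximal_config (prng g) (config_at Z g)]].

Definition frakU' : set (set gpath) := \bigcup_v frakU'_at v.

End SeparatedGraph.

Arguments frakF G : clear implicits.
Arguments frakU G : clear implicits.
Arguments frakU' G : clear implicits.

(* Main.v *)
Require Import Defs.
From mathcomp Require Import all_boot.
From mathcomp Require Import boolp classical_sets functions.
(* [functions] reuses the name of the constructor Inv. *)
Import Defs.

(** A lower set of C-separated paths based at v is a subtree of the tree of all
such paths, and the condition defining frakU' can be checked one letter at a time.
A maximal configuration at a vertex u consists of all inverse edges out of u
together with exactly one edge from each block of C_u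
([maximal_configP]).  So frakU' consists of the rooted trees which never
choose two edges of one block at the same node ([no_split]), which contain
every inverse edge that can be appended ([grows_inv]), and which choose an edge
from every block that can still be entered ([grows_fwd]); see [frakU'_atP].
Likewise, for a lower subset, being C-compatible just means [no_split]
([compatible_lowerP]), because the reduction of h^-1 g is what remains after
the longest common prefix of g and h has been cancelled, and the only turn at
which it can fail to be separated is the point where g and h part.

Hence an element of frakU' fails to be an ultrafilter only because of branches
that end in a tail of inverse edges and cannot be continued by an edge.  The bijection prunes them: [core] Z keeps the prefixes
of the elements of Z which do not end in an inverse edge.  Its inverse is [hull],
which appends to the elements of a set all tails of inverse edges that leave
them separated.

Suppose Z is in frakU' and Y is a compatible lower subset containing [core] Z.
Then Y is contained in Z ([grow_from_core]).  Indeed, follow an element of Y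
letter by letter: an inverse letter stays in Z by [grows_inv]; for an edge e, the
tree Z continues by some edge f of the block of e, this continuation does not
end in an inverse edge and so is in [core] Z, hence in Y, and e = f by
compatibility of Y.  This one statement gives both the maximality of
[core] Z and the injectivity of [core].

For surjectivity, let Z be maximal in frakF.  Everything about [hull] Z is
direct, except that an edge of each enterable block is chosen.  If this failed
for the block of e at a path w of [hull] Z, then adding w e and all its prefixes
to Z would give a strictly larger element of frakF ([hull_grows_fwd]). *)

Set Implicit Arguments.
Unset Strict Implicit.
Unset Printing Implicit Defensive.

Local Open Scope classical_set_scope.

(** * Turns and separated words *)

Lemma longest_common_prefix (T : Type) (g h : seq T) :
  exists a g' h', [/\ g = a ++ g', h = a ++ h' &
    forall x g'' y h'', g' = x :: g'' -> h' = y :: h'' -> x <> y].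
Proof.
elim: g h => [|x g IH] h; first by exists [::], [::], h; split.
case: h => [|y h]; first by exists [::], (x :: g), [::]; split.
have [<-|xy] := pselect (x = y).
  have [a [g' [h' [-> -> d]]]] := IH h.
  by exists (x :: a), g', h'; split.
exists [::], (x :: g), (y :: h); split=> //.
by move=> _ _ _ _ [<- _] [<- _].
Qed.

Section SeparatedPaths.
Variable G : sepgraph.

Local Notation word := (seq (letter G)).

Implicit Types (v : vert G) (x : letter G) (e f : edge G) (w : word).
Implicit Types Y Z : set (gpath G).

Definition same_block (e f : edge G) : Prop :=
  exists X, [/\ sep_class X, X e & X f].

Lemma same_block_refl e : same_block e e.
Proof.
have [cov _ _] := sg_partP (src e).
have : [set f | src f = src e] e by [].
by rewrite -cov => -[X CX Xe]; exists X; split=> //; exists (src e).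
Qed.

Lemma same_block_sym e f : same_block e f -> same_block f e.
Proof. by case=> X [CX Xe Xf]; exists X. Qed.

Lemma linvK : involutive (@linv G).
Proof. by case. Qed.

Lemma lsrc_inv (x : letter G) : lsrc (linv x) = lrng x.
Proof. by case: x. Qed.

Lemma lrng_inv (x : letter G) : lrng (linv x) = lsrc x.
Proof. by case: x. Qed.

(** The pairs of consecutive letters allowed in a separated path.  Both forbidden
patterns are covered: e^-1 e is excluded because e lies in its own block. *)
Definition good_turn (x y : letter G) : Prop :=
  match x, y with
  | Fwd e, Inv f => e <> f
  | Inv e, Fwd f => ~ same_block e f
  | _, _ => True
  end.

Definition step : rel (letter G) :=
  fun x y => `[< lsrc y = lrng x /\ good_turn x y >].

Lemma step_inv x y : step x y = step (linv y) (linv x).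
Proof.
apply/asboolP/asboolP; rewrite !lsrc_inv !lrng_inv => -[-> t]; split=> //;
  case: x y t => e [] f //= t.
- by move=> fe; apply: t.
- by move=> /same_block_sym.
- by move=> fe; apply: t.
- by move=> /same_block_sym.
Qed.

(** Reducedness alone, kept apart from [step] because words of the form
h^-1 g are reduced but possibly not separated. *)
Definition nocancel : rel (letter G) := fun x y => `[< y <> linv x >].

Lemma step_nocancel : subrel step nocancel.
Proof.
move=> x y /asboolP [_ t]; apply/asboolP.
case: x y t => e [] f //= t [fe]; apply: t => //.
by rewrite fe; apply: same_block_refl.
Qed.

Lemma nocancel_inv x y : nocancel x y = nocancel (linv y) (linv x).
Proof.
apply/asboolP/asboolP => t; first by rewrite linvK => xy; apply: t; rewrite xy.
by move=> xy; apply: t; rewrite xy linvK.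
Qed.

Definition endpoint (v : vert G) (w : word) : vert G := last v (map (@lrng G) w).

Lemma endpoint_rcons v w x : endpoint v (rcons w x) = lrng x.
Proof. by rewrite /endpoint map_rcons last_rcons. Qed.

Definition starts_at (v : vert G) (w : word) : Prop :=
  if w is x :: _ then lsrc x = v else True.

Definition sep_word (v : vert G) (w : word) : Prop :=
  starts_at v w /\ sorted step w.

Lemma subword_cons (u : word) x w : subword u w -> subword u (x :: w).
Proof. by case=> a [b ->]; exists (x :: a), b. Qed.

Lemma sorted_subword (e : rel (letter G)) w :
  sorted e w <-> (forall x y, subword [:: x; y] w -> e x y).
Proof.
split.
  move=> + x y [a [b E]]; rewrite {}E.
  by rewrite (sorted_cat_cons e a x (y :: b)) /= => /andP[_ /andP[]].
elim: w => [|x [|y w] IH] //= H; apply/andP; split.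
  by apply: H; exists [::], w.
by apply: IH => a b /(subword_cons x); apply: H.
Qed.

(** Being a path, reduced, and separated are all conditions on two consecutive
letters, so a separated path is a word sorted for [step]. *)
Lemma sep_pathsP v w : sep_paths (v, w) <-> sep_word v w.
Proof.
split.
  move=> [+ r s]; rewrite /is_path /= in r s *.
  elim: w v r s => [|x w IH] v r s //= [sx cw]; split=> //.
  have [] // : sep_word (lrng x) w.
    apply: IH => //.
      by move=> z /(subword_cons x); apply: r.
    by move=> X e f CX Xe Xf /(subword_cons x); apply: s Xf.
  case: w {IH cw} r s => [|y w] //= r s sy ->; rewrite andbT.
  apply/asboolP; split=> //; case: x y r s {sx sy} => e [] f r s //=.
    by move=> ef; apply: (r (Fwd e)); exists [::], w; rewrite ef.
  by case=> X [CX Xe Xf]; apply: (s X e f) => //; exists [::], w.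
case=> sv sw; split.
- rewrite /is_path /=; elim: w v sw sv => //= x w IH v pw <-; split=> //.
  case: w IH pw => [|y w] // IH /= /andP[/asboolP[sy _] pw].
  exact: (IH (lrng x) pw sy).
- move=> x; move/sorted_subword: sw => sw /sw /step_nocancel.
  by move/asboolP.
- move=> X e f CX Xe Xf; move/sorted_subword: sw => sw /sw.
  by move/asboolP => -[_]; apply; exists X.
Qed.

Lemma sep_word_cat v a b : sep_word v (a ++ b) -> sep_word v a.
Proof.
by case=> sv /cat_sorted2 [sa _]; split=> //; case: a sv {sa}.
Qed.

Lemma sep_word_rcons v w x :
  sep_word v (rcons w x) <->
  [/\ sep_word v w, lsrc x = endpoint v w &
      forall w' y, w = rcons w' y -> good_turn y x].
Proof.
case/lastP: w => [|w y].
  split=> [[]|[_ sx _]] //=; split=> //.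
  by case.
have E : rcons (rcons w y) x = w ++ y :: [:: x] by rewrite -cats1 cat_rcons.
have SE : sorted step (rcons (rcons w y) x) = sorted step (rcons w y) && step y x.
  by rewrite E sorted_cat_cons /= andbT.
have AE : starts_at v (rcons (rcons w y) x) = starts_at v (rcons w y).
  by case: w {E SE}.
rewrite /sep_word SE AE endpoint_rcons; split.
  move=> [sv /andP[sw /asboolP[sx t]]]; split=> //.
  by move=> w' z /rcons_inj [_ <-].
move=> [[sv sw] sx t]; split=> //; rewrite sw; apply/asboolP; split=> //.
exact: t.
Qed.

Lemma sep_word_src v a x b : sep_word v (a ++ x :: b) -> lsrc x = endpoint v a.
Proof. by rewrite -cat_rcons => /sep_word_cat /sep_word_rcons []. Qed.

Lemma wred_id w : sorted nocancel w -> wred w = w.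
Proof.
elim: w => [|x w IH] //= xw; rewrite IH; last exact: path_sorted xw.
case: w xw {IH} => [|y w] //= /andP[/asboolP xy _].
by case: asboolP.
Qed.

Definition winv (w : word) : word := rev (map (@linv G) w).

Lemma winv_cons x w : winv (x :: w) = rcons (winv w) (linv x).
Proof. by rewrite /winv /= rev_cons. Qed.

(** * Compatibility *)

(** Right folding reduces h^-1 a^-1 a g from the right, so the letters of a are
cancelled one by one against those of a^-1. *)
Lemma wred_common a h g :
  sorted nocancel (a ++ g) ->
  wred (winv (a ++ h) ++ a ++ g) = wred (winv h ++ g).
Proof.
elim: a => [|x a IH] //= xag.
have ag : sorted nocancel (a ++ g) by apply: path_sorted xag.
have pull u w : wred (u ++ w) = foldr (@cons_red G) (wred w) u.
  exact: foldr_cat.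
have -> : wred (winv (x :: a ++ h) ++ x :: a ++ g)
        = foldr (@cons_red G) (cons_red (linv x) (wred (x :: a ++ g)))
            (winv (a ++ h)).
  by rewrite winv_cons cat_rcons pull.
rewrite -IH // pull (@wred_id (x :: a ++ g)) // (wred_id ag) /= linvK.
by case: asboolP.
Qed.

Lemma sorted_winv_cat (e : rel (letter G)) h g :
    (forall x y, e x y = e (linv y) (linv x)) ->
    sorted e h -> sorted e g ->
    (forall x g' y h', g = x :: g' -> h = y :: h' -> e (linv y) x) ->
  sorted e (winv h ++ g).
Proof.
move=> einv sh sg j.
have sih : sorted e (winv h).
  rewrite /winv rev_sorted sorted_map.
  by rewrite (@eq_sorted _ _ e) // => x y /=; rewrite -einv.
case: g sg j => [|x g] sg j; first by rewrite cats0.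
rewrite sorted_cat_cons [path _ _ _]sg andbT.
case: h sih {sh} j => [|y h] // + j; rewrite winv_cons => sih.
rewrite -cats1 cat_rcons sorted_cat_cons sih /= andbT.
exact: (j x g y h).
Qed.

Lemma sorted_step_cat2 a b : sorted step (a ++ b) -> sorted step b.
Proof. by case/cat_sorted2. Qed.

(** When a is the longest common prefix nothing more cancels: the first letters of
g and h differ. *)
Lemma pdot_branch v a g h :
    sep_word v (a ++ g) -> sep_word v (a ++ h) ->
    (forall x g' y h', g = x :: g' -> h = y :: h' -> x <> y) ->
  pdot (pinv (v, a ++ h)) (v, a ++ g) = (endpoint v (a ++ h), winv h ++ g).
Proof.
move=> [_ sg] [_ sh] d; rewrite /pdot /pinv /path_red /pcat /=.
rewrite -/(winv _) wred_common; last exact: sub_sorted step_nocancel _ sg.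
congr pair; apply: wred_id; apply: sorted_winv_cat.
- exact: nocancel_inv.
- exact: sub_sorted step_nocancel _ (sorted_step_cat2 sh).
- exact: sub_sorted step_nocancel _ (sorted_step_cat2 sg).
- move=> x g' y h' Eg Eh; apply/asboolP; rewrite linvK => xy.
  exact: d Eg Eh xy.
Qed.

Definition never_splits (g h : word) : Prop :=
  forall a e f g' h',
    g = a ++ Fwd e :: g' -> h = a ++ Fwd f :: h' -> same_block e f -> e = f.

(** After cancelling the common prefix, the only turn of h^-1 g which is not a
turn of g or of the inverse of h is y^-1 x, where x and y are the first letters
at which g and h differ.  It is bad exactly when x and y are edges of one
block. *)
Lemma compatP v g h : sep_word v g -> sep_word v h ->
  compat v (v, g) (v, h) <-> never_splits g h.
Proof.
move=> sg sh; split.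
  move=> + a e f g' h' Eg Eh ef; rewrite {}Eg {}Eh in sg sh *.
  case=> [[]|[]|]; [by case: a {sg sh}|by case: a {sg sh}|].
  have [//|nef] := pselect (e = f).
  rewrite pdot_branch //; last by move=> _ _ _ _ [<- _] [<- _] [].
  case=> _ _ sep; have [X [CX Xe Xf]] := ef.
  case: (sep X f e) => //; exists (winv h'), g'.
  by rewrite winv_cons cat_rcons.
have [a [g' [h' [Eg Eh d]]]] := longest_common_prefix g h.
rewrite {}Eg {}Eh in sg sh * => ns; apply: Or33.
rewrite pdot_branch //; apply/sep_pathsP; split.
  case/lastP: h' sh {d ns} => [|h' y] sh.
    by rewrite cats0; case: g' sg => [|x g'] //= /sep_word_src.
  rewrite /winv map_rcons rev_rcons /= lsrc_inv -rcons_cat.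
  by rewrite endpoint_rcons.
have [_ sg1] := sg; have [_ sh1] := sh.
apply: sorted_winv_cat; [exact: step_inv| | |].
- exact: sorted_step_cat2 sh1.
- exact: sorted_step_cat2 sg1.
move=> x g'' y h'' Eg Eh; rewrite {}Eg {}Eh in sg sh d ns.
apply/asboolP; rewrite (sep_word_src sg) lrng_inv (sep_word_src sh); split=> //.
have xy := d _ _ _ _ erefl erefl.
case: x y xy {d} ns {sg sh sg1 sh1} => e [] f xy ns //=.
  move=> fe; apply: xy; rewrite (ns a e f g'' h'') //.
  exact: same_block_sym.
by move=> fe; apply: xy; rewrite fe.
Qed.

(** * Lower subsets and local configurations *)

Definition no_split (v : vert G) (Z : set (gpath G)) : Prop :=
  forall w e f, Z (v, rcons w (Fwd e)) -> Z (v, rcons w (Fwd f)) ->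
    same_block e f -> e = f.

Lemma lower_sep_word v Z w : lower_subset v Z -> Z (v, w) -> sep_word v w.
Proof. by case=> sub _ /sub [/sep_pathsP]. Qed.

Lemma lower_src v Z g : lower_subset v Z -> Z g -> g.1 = v.
Proof. by case=> sub _ /sub []. Qed.

Lemma lower_cat v Z a b : lower_subset v Z -> Z (v, a ++ b) -> Z (v, a).
Proof. by case=> _ low; apply: low; split=> //; exists b. Qed.

Lemma lower_rcons v Z w x : lower_subset v Z -> Z (v, rcons w x) -> Z (v, w).
Proof. by rewrite -cats1 => lZ; apply: lower_cat. Qed.

Lemma lower_root v Z : lower_subset v Z -> Z !=set0 -> Z (v, [::]).
Proof.
move=> lZ [[u w] Zg]; have /= uv := lower_src lZ Zg; subst u.
exact: (lower_cat (a := [::]) lZ Zg).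
Qed.

Lemma lower_of_rcons v Z :
    Z `<=` @sep_paths_at G v ->
    (forall w x, Z (v, rcons w x) -> Z (v, w)) ->
  lower_subset v Z.
Proof.
move=> sub dn; split=> // -[u a] [u' b] [/= <- [c ->]] Zb.
have /= [_ uv] := sub _ Zb; rewrite /psrc /= in uv; subst u.
elim/last_ind: c Zb => [|c x IH]; first by rewrite cats0.
by rewrite -rcons_cat => /dn.
Qed.

(** Induction along the tree: used to compare two trees node by node. *)
Lemma lower_sub v Y Z :
    lower_subset v Z -> Y (v, [::]) ->
    (forall w x, Y (v, w) -> Z (v, rcons w x) -> Y (v, rcons w x)) ->
  Z `<=` Y.
Proof.
move=> lZ Y0 grow [u w] Zw; have /= uv := lower_src lZ Zw; subst u.
elim/last_ind: w Zw => [|w x IH] Zw //.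
by apply: grow => //; apply: IH; apply: lower_rcons Zw.
Qed.

Lemma compatible_lowerP v Z :
  lower_subset v Z -> compatible_set v Z <-> no_split v Z.
Proof.
move=> lZ; split.
  move=> [_ cZ] w e f Ze Zf.
  have /compatP ns := cZ _ _ Ze Zf.
  by apply: (ns (lower_sep_word lZ Ze) (lower_sep_word lZ Zf) w e f [::] [::]);
    rewrite cats1.
move=> nZ; split; first by case: lZ.
move=> [u g] [u' h] Zg Zh.
have /= uv := lower_src lZ Zg; have /= uv' := lower_src lZ Zh; subst u u'.
apply/compatP; [exact: lower_sep_word Zg|exact: lower_sep_word Zh|].
move=> a e f g' h' Eg Eh; apply: (nZ a).
  by apply: (lower_cat (b := g')) => //; rewrite cat_rcons -Eg.
by apply: (lower_cat (b := h')) => //; rewrite cat_rcons -Eh.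
Qed.

Lemma admissibleP v (c : set (letter G)) :
  admissible v c <->
  [/\ c !=set0, forall x, c x -> lsrc x = v &
      forall e f, c (Fwd e) -> c (Fwd f) -> same_block e f -> e = f].
Proof.
split.
  move=> [[c0 src_c] [_ comp]]; split=> // e f ce cf ef.
  have se := src_c _ ce; have sf := src_c _ cf.
  have /= := comp _ _ (ex_intro2 _ _ _ ce erefl) (ex_intro2 _ _ _ cf erefl).
  rewrite /lpath se sf => /compatP ns.
  by apply: (ns _ _ [::] e f [::] [::]).
move=> [c0 src_c ns]; split; first by split.
split.
  move=> _ [x cx <-]; rewrite /lpath (src_c _ cx); split=> //.
  by apply/sep_pathsP; split=> //=; apply: src_c.
move=> _ _ [x cx <-] [y cy <-]; rewrite /lpath (src_c _ cx) (src_c _ cy).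
have sx := src_c _ cx; have sy := src_c _ cy.
apply/compatP => // a e f g' h'; case: a => [|z [|? ?]] //= [Ex _] [Ey _].
by apply: ns; rewrite -?Ex -?Ey.
Qed.

(** An inverse edge is compatible with every letter, and an edge conflicts only
with the other edges of its block; so maximality forces all inverse edges and
one edge from each block. *)
Lemma maximal_configP v (c : set (letter G)) :
  maximal_config v c <->
  [/\ admissible v c, forall e, rng e = v -> c (Inv e) &
      forall e, src e = v -> exists2 f, c (Fwd f) & same_block e f].
Proof.
split.
  move=> [ac cmax]; have /admissibleP [c0 src_c ns] := ac.
  (* Maximality: a letter without conflict with c already belongs to c. *)
  have add x : lsrc x = v ->
      (forall e f, x = Fwd e -> c (Fwd f) -> same_block e f -> e = f) -> c x.
    move=> sx nx; rewrite -(cmax (c `|` [set x])); first by right.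
      apply/admissibleP; split.
      - by exists x; right.
      - by move=> y [/src_c //|->].
      - move=> e f [ce|ex] [cf|fx] ef.
        + exact: ns.
        + by apply/esym; apply: nx ce (same_block_sym ef); rewrite -fx.
        + by apply: nx cf ef; rewrite -ex.
        + by move: fx; rewrite -ex => -[].
    by move=> y; left.
  split=> // [e re|e se]; first by apply: add.
  have [//|none] := pselect (exists2 f, c (Fwd f) & same_block e f).
  exists e; last exact: same_block_refl.
  apply: add => // _ f [<-] cf ef; case: none; by exists f.
move=> [ac cinv cfwd]; split=> // d /admissibleP [_ src_d nd] cd.
apply/seteqP; split=> // -[] e de; last by apply: cinv; apply: (src_d _ de).
have [f cf ef] := cfwd e (src_d _ de).
by rewrite (nd e f de (cd _ cf) ef).
Qed.

(** The product of (v, w) with a letter x either extends w or, when x is the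
inverse of the last letter, goes back to the parent node, which lies in any
lower subset. *)
Lemma config_atE v Z w x : lower_subset v Z -> Z (v, w) ->
  config_at Z (v, w) x <->
  Z (v, rcons w x) \/ exists w', w = rcons w' (linv x).
Proof.
move=> lZ Zw; have sw := lower_sep_word lZ Zw.
have sw' : sorted nocancel w by apply: sub_sorted step_nocancel _ sw.2.
have pull y : wred (rcons w y) = foldr (@cons_red G) [:: y] w.
  by rewrite -cats1 /wred foldr_cat.
have red_stay y : Z (v, rcons w y) -> wred (rcons w y) = rcons w y.
  move=> Zy; apply: wred_id; apply: sub_sorted step_nocancel _ _.
  by case: (lower_sep_word lZ Zy).
rewrite /config_at /prng /pdot /path_red /pcat /lpath /= cats1.
rewrite -/(endpoint v w); split.
  move=> [sx]; have [[w' Ew]|nback] := pselect (exists w', w = rcons w' (linv x)).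
    by move=> _; right; exists w'.
  rewrite wred_id; first by left.
  case/lastP: w sw' nback {Zw sw pull red_stay sx} => // w y sw nback.
  rewrite -cats1 cat_rcons sorted_cat_cons sw /= andbT.
  apply/asboolP => xy; apply: nback; exists w.
  by rewrite xy linvK.
case=> [Zx|[w' Ew]].
  rewrite red_stay //; split=> //.
  by have /sep_word_rcons[] := lower_sep_word lZ Zx.
rewrite pull Ew foldr_rcons /= linvK.
have -> : `[< x = x >] by apply/asboolP.
rewrite endpoint_rcons lrng_inv; split=> //.
rewrite Ew in Zw sw'; rewrite -/(wred w') wred_id; first exact: lower_rcons Zw.
by move: sw'; rewrite -cats1 => /cat_sorted2[].
Qed.

(** * Letterwise descriptions of frakU' and frakF *)

Definition grows_inv v (Z : set (gpath G)) : Prop :=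
  forall w e, Z (v, w) -> sep_word v (rcons w (Inv e)) -> Z (v, rcons w (Inv e)).

(** If w ends in f^-1 with f in the block of e, then w e is not separated: at such
a node the edge of that block in the configuration is f itself, the way back. *)
Definition grows_fwd v (Z : set (gpath G)) : Prop :=
  forall w e, Z (v, w) -> sep_word v (rcons w (Fwd e)) ->
    exists2 f, Z (v, rcons w (Fwd f)) & same_block e f.

(** The letter leading back to the parent accounts for the difference between
configurations and extensions of w.  Absence of isolated vertices makes every
configuration nonempty, so that a tree satisfying the growth conditions is
non-trivial. *)
Lemma frakU'_atP (noisolated : forall v : vert G, ~ isolated v) v Z :
  frakU'_at v Z <->
  [/\ lower_subset v Z, Z (v, [::]), no_split v Z, grows_inv v Z & grows_fwd v Z].
Proof.
split.
  move=> [lZ [g [_ [Zg _ _]]] cfg]; split=> //.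
  - by apply: lower_root => //; exists g.
  - move=> w e f Ze Zf.
    have Zw := lower_rcons lZ Ze.
    have /maximal_configP [/admissibleP [_ _ ns] _ _] := cfg _ Zw.
    by apply: ns; apply/(config_atE _ lZ Zw); left.
  - move=> w e Zw /sep_word_rcons [_ se t].
    have /maximal_configP [_ cinv _] := cfg _ Zw.
    have /(config_atE _ lZ Zw) [//|[w' Ew]] := cinv e se.
    by case: (t _ _ Ew).
  - move=> w e Zw /sep_word_rcons [_ se t].
    have /maximal_configP [_ _ cfwd] := cfg _ Zw.
    have [f /(config_atE _ lZ Zw) cf ef] := cfwd e se.
    exists f => //; case: cf => // -[w' Ew].
    by case: (t _ _ Ew); apply: same_block_sym.
move=> [lZ Z0 ns gi gf].
have cinv w e : Z (v, w) -> rng e = endpoint v w -> config_at Z (v, w) (Inv e).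
  move=> Zw re; apply/(config_atE _ lZ Zw).
  have [|nback] := pselect (exists w', w = rcons w' (Fwd e)); first by right.
  left; apply: gi => //; apply/sep_word_rcons; split=> //.
    exact: lower_sep_word Zw.
  by move=> w' [f|f] Ew //= fe; apply: nback; exists w'; rewrite Ew fe.
have cfwd w e : Z (v, w) -> src e = endpoint v w ->
    exists2 f, config_at Z (v, w) (Fwd f) & same_block e f.
  move=> Zw se.
  have [[w' [f [Ew fe]]]|nback] :=
    pselect (exists w' f, w = rcons w' (Inv f) /\ same_block f e).
    exists f; last exact: same_block_sym.
    by apply/(config_atE _ lZ Zw); right; exists w'.
  have [|f Zf ef] := gf w e Zw.
    apply/sep_word_rcons; split=> //; first exact: lower_sep_word Zw.
    by move=> w' [f|f] Ew //= fe; apply: nback; exists w', f.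
  by exists f => //; apply/(config_atE _ lZ Zw); left.
have cfg w : Z (v, w) -> config_at Z (v, w) !=set0.
  move=> Zw; have := @noisolated (endpoint v w); apply: contra_notP => c0.
  split; apply/seteqP; split=> // e /= pe; apply: c0.
    by have [f cf _] := cfwd w e Zw pe; exists (Fwd f).
  by exists (Inv e); apply: cinv.
split=> //.
  have [x /(config_atE _ lZ Z0) [Zx|[w]]] := cfg _ Z0; last by case: w.
  by exists (v, [::]), (v, rcons [::] x).
move=> [u w] Zw; have /= uv := lower_src lZ Zw; subst u.
apply/maximal_configP.
split; [|by move=> e; apply: cinv|by move=> e; apply: cfwd].
apply/admissibleP; split; [exact: cfg|by move=> x []|].
(* An extension of w by an edge cannot reuse the block of the way back. *)
have turn_back e f w' : w = rcons w' (Inv e) -> Z (v, rcons w (Fwd f)) ->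
    ~ same_block e f.
  by move=> Ew /(lower_sep_word lZ) /sep_word_rcons [_ _ t]; apply: (t _ _ Ew).
move=> e f /(config_atE _ lZ Zw) [Ze|[w1 E1]] /(config_atE _ lZ Zw) [Zf|[w2 E2]].
- exact: ns Ze Zf.
- by move/same_block_sym/(turn_back _ _ _ E2 Ze).
- by move/(turn_back _ _ _ E1 Zf).
- by move: E2; rewrite E1 => /rcons_inj [_ []].
Qed.

Lemma frakF_atP v Z :
  frakF_at v Z <->
  [/\ lower_subset v Z, Z (v, [::]), no_split v Z &
    forall z, Z z -> exists z', [/\ Z z', pprefix z z' & ~ ends_in_inv z']].
Proof.
split=> [[Z0 lZ cZ ext]|[lZ Z0 nZ ext]]; split=> //.
- exact: lower_root.
- exact/compatible_lowerP.
- by exists (v, [::]).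
- exact/compatible_lowerP.
Qed.

(** * Pruning tails of inverse edges *)

Definition core (Z : set (gpath G)) : set (gpath G) :=
  [set z | exists z', [/\ Z z', pprefix z z' & ~ ends_in_inv z']].

Lemma pprefix_refl (g : gpath G) : pprefix g g.
Proof. by split=> //; exists [::]; rewrite cats0. Qed.

Lemma pprefix_trans (g h k : gpath G) : pprefix g h -> pprefix h k -> pprefix g k.
Proof.
move=> [E1 [u Eu]] [E2 [w Ew]]; split; first by rewrite E1.
by exists (u ++ w); rewrite Ew Eu catA.
Qed.

Lemma fwd_not_inv v (w : word) e : ~ ends_in_inv (v, rcons w (Fwd e)).
Proof. by move=> [u [f /= /rcons_inj]]. Qed.

Lemma root_not_inv v : ~ @ends_in_inv G (v, [::]).
Proof. by move=> [u [e]]; case: u. Qed.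

Lemma core_fwd v Z w e : Z (v, rcons w (Fwd e)) -> core Z (v, rcons w (Fwd e)).
Proof.
move=> Ze; exists (v, rcons w (Fwd e)); split=> //; first exact: pprefix_refl.
exact: fwd_not_inv.
Qed.

Lemma core_sub v Z : lower_subset v Z -> core Z `<=` Z.
Proof. by move=> [_ low] z [z' [Zz' zz' _]]; apply: low Zz'. Qed.

Lemma core_lower v Z : lower_subset v Z -> lower_subset v (core Z).
Proof.
move=> lZ; split=> [g /(core_sub lZ)|g h gh [k [Zk hk nk]]].
  by case: lZ => sub _; apply: sub.
by exists k; split=> //; apply: pprefix_trans gh hk.
Qed.

Lemma core_root v Z : Z (v, [::]) -> core Z (v, [::]).
Proof.
move=> Z0; exists (v, [::]); split=> //; first exact: pprefix_refl.
exact: root_not_inv.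
Qed.

Lemma core_frakF v Z :
  lower_subset v Z -> Z (v, [::]) -> no_split v Z -> frakF_at v (core Z).
Proof.
move=> lZ Z0 ns; apply/frakF_atP; split.
- exact: core_lower.
- exact: core_root.
- by move=> w e f /(core_sub lZ) Ze /(core_sub lZ) Zf; apply: ns Ze Zf.
- move=> z [z' [Zz' zz' nz']]; exists z'; split=> //.
  by exists z'; split=> //; apply: pprefix_refl.
Qed.

(** [core] Z records every edge chosen by Z; a compatible Y above it cannot choose
another one, and all inverse edges are already in Z. *)
Lemma grow_from_core v Z Y :
    lower_subset v Z -> Z (v, [::]) -> grows_inv v Z -> grows_fwd v Z ->
    lower_subset v Y -> no_split v Y -> core Z `<=` Y -> Y `<=` Z.
Proof.
move=> lZ Z0 gi gf lY nY ZY.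
apply: (lower_sub lY Z0) => w [e|e] Zw Ye; last first.
  by apply: gi => //; apply: lower_sep_word Ye.
have [f Zf ef] := gf w e Zw (lower_sep_word lY Ye).
by rewrite (nY w e f Ye (ZY _ (core_fwd Zf)) ef).
Qed.

Lemma core_frakU (noisolated : forall v : vert G, ~ isolated v) :
  {homo core : Z / frakU' G Z >-> frakU G Z}.
Proof.
move=> Z [v _ /(frakU'_atP noisolated) [lZ Z0 ns gi gf]]; split.
  by exists v => //; apply: core_frakF.
move=> Y [u _ /frakF_atP [lY Y0 nY extY]] sub.
have vu : v = u by apply: (lower_src lY (sub _ (core_root Z0))).
subst u; apply/seteqP; split=> // y /extY [y' [Yy' yy' ny']].
by exists y'; split=> //; exact: (grow_from_core lZ Z0 gi gf lY nY sub).
Qed.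

Lemma core_inj (noisolated : forall v : vert G, ~ isolated v) :
  set_inj (frakU' G) core.
Proof.
have half Y Z : frakU' G Y -> frakU' G Z -> core Y = core Z -> Y `<=` Z.
  move=> [u _ /(frakU'_atP noisolated) [lY Y0 nY _ _]].
  move=> [v _ /(frakU'_atP noisolated) [lZ Z0 _ gi gf]] E.
  have uv : u = v.
    apply: (lower_src lZ (core_sub lZ (_ : core Z (u, [::])))).
    by rewrite -E; apply: core_root.
  subst u; apply: (grow_from_core lZ Z0 gi gf lY nY).
  by rewrite -E; apply: core_sub lY.
move=> Y Z /set_mem UY /set_mem UZ E.
by apply/seteqP; split; apply: half.
Qed.

(** * Adding tails of inverse edges *)

Definition hull (Z : set (gpath G)) : set (gpath G) :=
  [set g | sep_paths g /\
    exists w u, g.2 = w ++ map (@Inv G) u /\ Z (g.1, w)].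

Lemma hull_sub Z : Z `<=` @sep_paths G -> Z `<=` hull Z.
Proof.
move=> sub [v w] Zw; split; first exact: sub.
by exists w, [::]; rewrite cats0.
Qed.

Lemma hull_rcons v Z w x :
  hull Z (v, rcons w x) ->
  Z (v, rcons w x) \/ hull Z (v, w) /\ exists e, x = Inv e.
Proof.
move=> [/sep_pathsP /sep_word_rcons [sw _ _] [w' [u [/= + Zw']]]].
case/lastP: u => [|u e]; first by rewrite cats0 => ->; left.
rewrite map_rcons -rcons_cat => /rcons_inj [Ew Ex]; right.
split; last by exists e.
by split; [exact/sep_pathsP|exists w', u].
Qed.

(** Only inverse letters are appended, so the edges chosen by [hull] Z are those
chosen by Z. *)
Lemma hull_fwd v Z w e : hull Z (v, rcons w (Fwd e)) -> Z (v, rcons w (Fwd e)).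
Proof. by case/hull_rcons => // -[_ []]. Qed.

Lemma hull_lower v Z : lower_subset v Z -> lower_subset v (hull Z).
Proof.
move=> lZ; apply: lower_of_rcons.
  move=> [u w] [sw [w' [_ [_ Zw']]]]; split=> //.
  exact: (lower_src lZ Zw').
move=> w x /hull_rcons [Zx|[]] //.
apply: hull_sub; last exact: lower_rcons Zx.
by move=> z /lZ.1 [].
Qed.

Lemma hull_grows_inv v Z : grows_inv v (hull Z).
Proof.
move=> w e [_ [w' [u [/= Ew Zw']]]] sw; split; first exact/sep_pathsP.
by exists w', (rcons u e); rewrite map_rcons -rcons_cat -Ew.
Qed.

Lemma core_hull v Z : frakF_at v Z -> core (hull Z) = Z.
Proof.
move=> /frakF_atP [lZ Z0 nZ ext]; apply/seteqP; split.
  move=> z [[u w] [hz' zz' nz']]; apply: (lZ.2 _ _ zz').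
  have /= uv := lower_src (hull_lower lZ) hz'; subst u.
  case/lastP: w hz' nz' {zz'} => [|w x] // /hull_rcons [//|[_ [e ->]]] [].
  by exists w, e.
move=> z /ext [z' [Zz' zz' nz']]; exists z'; split=> //.
by apply: hull_sub Zz' => y /lZ.1 [].
Qed.

Lemma pprefix_rcons (g : gpath G) v w x :
  pprefix g (v, rcons w x) -> g = (v, rcons w x) \/ pprefix g (v, w).
Proof.
case: g => u a [/= -> [b]]; case/lastP: b => [|b y].
  by rewrite cats0 => ->; left.
by rewrite -rcons_cat => /rcons_inj [-> _]; right; split=> //; exists b.
Qed.

(** If no edge of the block of e follows w, then Z together with the branch from
the root to w e is still in frakF, and maximality of Z puts w e in Z. *)
Lemma hull_grows_fwd v Z : frakF_at v Z ->
  (forall Y, frakF G Y -> Z `<=` Y -> Y = Z) -> grows_fwd v (hull Z).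
Proof.
move=> /frakF_atP [lZ Z0 nZ ext] Zmax w e hw se.
have subZ : Z `<=` @sep_paths G by move=> y /lZ.1 [].
have [[f Zf ef]|none] :=
  pselect (exists2 f, Z (v, rcons w (Fwd f)) & same_block e f).
  by exists f => //; apply: hull_sub.
exists e; last exact: same_block_refl.
apply: hull_sub => //; set p := (v, rcons w (Fwd e)).
pose Y := Z `|` [set g | pprefix g p].
have Yp : Y p by right; apply: pprefix_refl.
rewrite -(Zmax Y) //; last by move=> z; left.
exists v => //; apply/frakF_atP.
(* The new branch w e meets [hull] Z in w, so its only new edge is the last. *)
have old a f : Y (v, rcons a (Fwd f)) ->
    Z (v, rcons a (Fwd f)) \/ rcons a (Fwd f) = rcons w (Fwd e).
  case=> [|/pprefix_rcons [[]|pw]]; [by left|by right|left].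
  apply: hull_fwd; exact: (hull_lower lZ).2 pw hw.
have new a f g : Z (v, rcons a (Fwd f)) -> rcons a (Fwd g) = rcons w (Fwd e) ->
    ~ same_block g f.
  by move=> Zf /rcons_inj [Ea Eg] ef; apply: none; exists f; rewrite -?Ea -?Eg.
split.
- split.
    move=> z [/lZ.1 //|[Ez [b Eb]]]; split; last exact: Ez.
    case: z Ez Eb => u a /= -> Ea; apply/sep_pathsP.
    by rewrite Ea in se; apply: sep_word_cat se.
  move=> g h gh [Zh|hp]; first by left; apply: lZ.2 gh Zh.
  by right; apply: pprefix_trans gh hp.
- by left.
- move=> a f g /old [Zf|Ef] /old [Zg|Eg] fg.
  + exact: nZ Zf Zg fg.
  + by case: (new _ _ _ Zf Eg); apply: same_block_sym.
  + by case: (new _ _ _ Zg Ef).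
  + by move: Eg; rewrite -Ef => /rcons_inj [].
- move=> z [/ext [z' [Zz' zz' nz']]|zp]; first by exists z'; split=> //; left.
  by exists p; split=> //; apply: fwd_not_inv.
Qed.

Lemma core_surj (noisolated : forall v : vert G, ~ isolated v) :
  set_surj (frakU' G) (frakU G) core.
Proof.
move=> Z [[v _ FZ] Zmax]; exists (hull Z); last exact: core_hull FZ.
have /frakF_atP [lZ Z0 nZ ext] := FZ.
exists v => //; apply/(frakU'_atP noisolated); split.
- exact: hull_lower.
- by apply: hull_sub Z0 => y /lZ.1 [].
- by move=> w e f /hull_fwd Ze /hull_fwd Zf; apply: nZ Ze Zf.
- exact: hull_grows_inv.
- exact: hull_grows_fwd.
Qed.

End SeparatedPaths.

Theorem theorem5p7 (G : sepgraph) (noisolated : forall v : vert G, ~ isolated v) :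
  exists f : set (gpath G) -> set (gpath G), set_bij (frakU' G) (frakU G) f.
Proof.
exists (@core G); split.
- exact: core_frakU.
- exact: core_inj.
- exact: core_surj.
Qed.
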